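(* Let $n>2$ be an integer. (1) The volume of $P(C_n)$ is $\frac{1}{(n-1)!}$, and the Ehrhart polynomial of $P(C_n)$ is $i(P(C_n),t)=\binom{t+n-1}{n-1}$. (2) If $n$ is odd, the volume of $P(D_n)$ is $\frac{n}{(2n-2)!}$, and the Ehrhart polynomial of $P(D_n)$ is \[ \sum_{k=0}^{n-2} \binom{2n}{k+1} \binom{t-1}{k} + \sum_{k=n-1}^{2n-2} \left( \binom{2n}{k+1} - \binom{n}{k-n+1} \right) \binom{t-1}{k}. \] (3) If $n$ is even, $n=2m$, the volume of $P(D_n)$ is $\frac{n^2}{4\cdot(2n-3)!}$, and the Ehrhart polynomial of $P(D_n)$ is \begin{align*} \sum_{k=0}^{m-2} \binom{2n}{k+1} \binom{t-1}{k} + \sum_{k=m-1}^{2m-2} \left( \binom{2n}{k+1} - 2\binom{2n-m}{k+1-m} \right) \binom{t-1}{k} +& \\ \sum_{k=2m-1}^{4m-3} \left( \binom{2n}{k+1} - 2 \binom{2n-m}{k+1-m} + \binom{2n-2m}{k+1-2m} \right) \binom{t-1}{k}.& \end{align*}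
   Context: Each permutation $g\in S_n$ is identified with the $n\times n$ permutation matrix whose $(i,j)$-entry is $1$ if $g(i)=j$ and $0$ otherwise. For a subgroup $G\le S_n$, the permutation polytope is $P(G)=\mathrm{conv}\{g : g\in G\}\subset\mathbb{R}^{n\times n}$. The cyclic group $C_n\le S_n$ is generated by $(1\ 2\ \cdots\ n)$. The dihedral group $D_n\le S_n$ is generated by $r=(1\ 2\ \cdots\ n)$ and $f=(1\ n)(2\ n-1)\cdots(\lfloor\frac{n+1}{2}\rfloor\ \lceil\frac{n+1}{2}\rceil)$. For a lattice polytope $P\subset\mathbb{R}^{n\times n}$, its Ehrhart polynomial $i(P,t)$ is the polynomial with $i(P,t)=|tP\cap\mathbb{Z}^{n\times n}|$ for positive integers $t$. The volume of a $d$-dimensional lattice polytope $P$ means its relative volume, i.e. the leading coefficient of $i(P,t)$; equivalently the $d$-dimensional volume normalized so that a $d$-simplex whose edge vectors from one vertex form a basis of the lattice $\mathrm{aff}(P)\cap\mathbb{Z}^{n\times n}$ has volume $\frac{1}{d!}$. *)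

(* Defs.v *)
From HB Require Import structures.
From mathcomp Require Import all_boot all_order all_algebra all_fingroup.
From mathcomp Require Import reals.
Set Implicit Arguments. Unset Strict Implicit. Unset Printing Implicit Defensive.
Import Order.TTheory GRing.Theory Num.Theory.
Local Open Scope ring_scope.

(* Points {1,...,n} of the paper are encoded as 'I_n = {0,...,n-1} (i <-> i-1). *)

Definition pmat (R : nzRingType) n (g : 'S_n) : 'M[R]_n :=
  \matrix_(i, j) (if g i == j then 1 else 0).

Definition rot n : 'S_n := perm (@ordS_inj n).
Definition flip n : 'S_n := perm (@rev_ord_inj n).

Definition Cn n : {group 'S_n} := <[rot n]>%G.
Definition Dn n : {group 'S_n} := <<[set rot n; flip n]>>%G.

(* M lies in t * P(G), P(G) = conv{ pmat g : g in G } in R^{n x n} *)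
Definition in_dilate (R : realType) n (G : {set 'S_n}) (t : nat) (M : 'M[int]_n) : Prop :=
  exists lam : 'S_n -> R,
    (forall g, 0 <= lam g) /\
    \sum_(g in G) lam g = t%:R /\
    map_mx (fun z : int => z%:~R) M = \sum_(g in G) lam g *: pmat R g.

Definition ehrhart (R : realType) n (G : {set 'S_n}) (p : {poly rat}) : Prop :=
  forall t : nat, (0 < t)%N ->
    exists S : seq 'M[int]_n,
      uniq S /\ (forall M, M \in S <-> in_dilate R G t M) /\
      (size S)%:R = p.[t%:R].

(* relative volume = leading coefficient of the Ehrhart polynomial *)
Definition volume (R : realType) n (G : {set 'S_n}) (v : rat) : Prop :=
  exists p : {poly rat}, ehrhart R G p /\ lead_coef p = v.

Definition binp (a : int) (k : nat) : {poly rat} :=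
  (k`!%:R)^-1 *: \prod_(i < k) ('X + ((a - i%:Z)%:~R)%:P).

Definition ehrC (n : nat) : {poly rat} := binp (n.-1)%:Z n.-1.

Definition ehrD_odd (n : nat) : {poly rat} :=
  \sum_(0 <= k < n.-1) ('C(n.*2, k.+1)%:R *: binp (-1) k) +
  \sum_(n.-1 <= k < (n.*2).-1)
     (('C(n.*2, k.+1)%:R - 'C(n, k.+1 - n)%:R) *: binp (-1) k).

Definition ehrD_even (m : nat) : {poly rat} :=
  let n := m.*2 in
  \sum_(0 <= k < m.-1) ('C(n.*2, k.+1)%:R *: binp (-1) k) +
  \sum_(m.-1 <= k < (m.*2).-1)
     (('C(n.*2, k.+1)%:R - 2 * 'C(n.*2 - m, k.+1 - m)%:R) *: binp (-1) k) +
  \sum_((m.*2).-1 <= k < (m * 4).-2)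
     (('C(n.*2, k.+1)%:R - 2 * 'C(n.*2 - m, k.+1 - m)%:R
        + 'C(n.*2 - m.*2, k.+1 - m.*2)%:R) *: binp (-1) k).

(* Main.v *)
Require Import Defs.
From HB Require Import structures.
From mathcomp Require Import all_boot all_order all_algebra all_fingroup.
From mathcomp Require Import reals.
From mathcomp Require Import zify ring.
Import Order.TTheory GRing.Theory Num.Theory.
Local Open Scope ring_scope.

(* On Z/n the rotations are i |-> i + k and the reflections i |-> l - i, so the
   points of t P(D_n) are the matrices M i j = a (j - i) + b (i + j) with
   nonnegative weights a, b of total mass t.  The pair (j - i, i + j) takes every
   value (x, y) with x, y of equal parity (every value at all if n is odd), hence
   the only freedom in (a, b) is to move a constant from a to b on each parity
   class.  Making the minimum of a on each class equal to 0 picks a unique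
   representative, which is integral when M is, without changing the total mass.
   Lattice points are therefore counted by weights of mass t minus those which
   are positive on a whole class, i.e. by inclusion-exclusion, and Vandermonde's
   identity turns the resulting binomials into the stated sums. *)

(** * Counting natural weights of given total, and a binomial sum *)

Section Count.
Local Open Scope nat_scope.

(** Stars and bars. Each value is at most the total, so the codomain ['I_s.+1] loses no function;
    passing to graphs reduces the count to tuples. *)
Lemma card_ffun_sum (T : finType) (s : nat) : 0 < #|T| ->
  #|[set f : {ffun T -> 'I_s.+1} | \sum_x (f x : nat) == s]| =
  'C(#|T|.-1 + s, #|T|.-1).
Proof.
have tuples N : 0 < N -> #|[set u : N.-tuple 'I_s.+1 | \sum_(i <- u) (i : nat) == s]|
   = 'C(N.-1 + s, N.-1).
  by case: N => // m _; rewrite card_ord_partitions.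
move=> T0; rewrite -tuples //.
have sumE (f : {ffun T -> 'I_s.+1}) : \sum_(i <- fgraph f) (i : nat) = \sum_x (f x : nat).
  by rewrite -codom_ffun /codom /image_mem big_map big_enum.
rewrite -(card_imset _ (can_inj (@fgraphK T 'I_s.+1))).
apply: eq_card => u; rewrite inE; apply/imsetP/idP => [[f] | su].
  by rewrite inE -sumE => sf ->.
by exists (Finfun u); rewrite ?inE -?sumE FinfunK.
Qed.

(** Lowering the values on [K] by 1 leaves an arbitrary weight of total [t - #|K|], so stars and
    bars applies. If [t < #|K|] there is no such function, and the binomial vanishes as well. *)
Lemma card_ffun_sum_pos (T : finType) (K : {set T}) (t : nat) : 0 < #|T| -> 0 < t ->
  #|[set f : {ffun T -> 'I_t.+1} |
      (\sum_x (f x : nat) == t) && [forall x in K, 0 < f x]]| =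
  'C(#|T| - #|K| + t.-1, #|T|.-1).
Proof.
move=> T0 t0; have KT : #|K| <= #|T| := max_card _.
have sumK : \sum_x (x \in K : nat) = #|K|.
  by rewrite -sum1_card [RHS]big_mkcond; apply: eq_bigr => x _; case: (x \in K).
have [Kt | tK] := leqP #|K| t; last first.
  rewrite bin_small; last lia.
  apply: eq_card0 => f; rewrite inE; apply/negbTE/negP => /andP[/eqP sf /forall_inP pf].
  move: tK; rewrite ltnNge -[X in _ <= X]sf -sumK leq_sum // => x _.
  by case: (boolP (x \in K)) => // /pf.
set s := t - #|K|.
pose h (g : {ffun T -> 'I_s.+1}) : {ffun T -> 'I_t.+1} :=
  [ffun x => inord (g x + (x \in K))].
have hE g x : h g x = g x + (x \in K) :> nat.
  rewrite ffunE inordK // ltnS.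
  case: (boolP (x \in K)) => [xK|_]; last by have := ltn_ord (g x); rewrite /s; lia.
  have : 0 < #|K| by apply/card_gt0P; exists x.
  by have := ltn_ord (g x); rewrite /s /=; lia.
have h_inj : injective h.
  move=> g g' e; apply/ffunP => x; apply: val_inj => /=.
  by apply: (@addIn (x \in K)); rewrite -!hE e.
transitivity #|h @: [set g : {ffun T -> 'I_s.+1} | \sum_x (g x : nat) == s]|.
  apply: eq_card => f; rewrite inE; apply/andP/imsetP => [[/eqP sf /forall_inP pf]|[g]].
    have Kf x : (x \in K) <= f x by case: (boolP (x \in K)) => // /pf.
    have sg : \sum_x (f x - (x \in K)) = s.
      by rewrite sumnB // sumK sf.
    have fs x : f x - (x \in K) < s.+1.
      by rewrite ltnS -sg (bigD1 x) //= leq_addr.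
    exists [ffun x => inord (f x - (x \in K))].
      by rewrite inE -[X in _ == X]sg; apply/eqP/eq_bigr => x _; rewrite ffunE inordK.
    by apply/ffunP => x; apply: val_inj; rewrite /= hE ffunE inordK // subnK.
  rewrite inE => /eqP sg ->; split.
    under eq_bigr do rewrite hE.
    by rewrite big_split /= sg sumK subnK.
  by apply/forall_inP => x xK; rewrite hE xK addn1.
rewrite card_imset // card_ffun_sum //; congr 'C(_, _); rewrite /s; lia.
Qed.

(** Vandermonde's identity after the symmetry ['C(N - j, k.+1 - j) = 'C(N - j, N - k.+1)]. For
    [k.+1 < j] the right-hand binomial is 0, which accounts for the indices left out of the sum. *)
Lemma sum_bin_bin (N j t : nat) : 0 < N -> j <= N -> 0 < t ->
  \sum_(0 <= k < N | j <= k.+1) 'C(N - j, k.+1 - j) * 'C(t.-1, k) =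
  'C(N - j + t.-1, N.-1).
Proof.
case: N => [//|N] _ jN t0; rewrite addnC -binomial.Vandermonde big_mkord.
rewrite [LHS]big_mkcond /=; apply: eq_bigr => k _; rewrite mulnC.
have kN := ltn_ord k.
case: leqP => jk; last by rewrite (bin_small (_ : N.+1 - j < N - k)) ?muln0; lia.
congr (_ * _); rewrite -(@bin_sub (N.+1 - j) (k.+1 - j)); last lia.
by congr 'C(_, _); lia.
Qed.
End Count.

(** * Values, degrees and leading coefficients of the binomial polynomials *)

Lemma prod_natrB_ffact (R : comNzRingType) (s k : nat) :
  \prod_(i < k) (s%:R - (i : nat)%:R) = (s ^_ k)%:R :> R.
Proof.
elim: k => [|k IHk]; first by rewrite big_ord0.
rewrite big_ord_recr /= IHk ffactnSr natrM.
by have [ks | sk] := leqP k s; [rewrite natrB | rewrite ffact_small // !mul0r].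
Qed.

(** The product evaluates to a falling factorial of [s] with [k] factors; for [s < k] it contains
    the factor 0, in agreement with ['C(s, k) = 0]. *)
Lemma horner_binp (a : int) (t s k : nat) : t%:Z + a = s%:Z ->
  (binp a k).[t%:R] = 'C(s, k)%:R.
Proof.
move=> e; rewrite hornerZ horner_prod.
under eq_bigr => i _.
  rewrite !hornerE pmulrn -intrD addrA e intrB -!pmulrn.
over.
rewrite prod_natrB_ffact -bin_ffact natrM mulrC mulfK // pnatr_eq0.
by rewrite -lt0n fact_gt0.
Qed.

Lemma size_lead_binp (a : int) (k : nat) :
  size (binp a k) = k.+1 /\ lead_coef (binp a k) = (k`!)%:R^-1.
Proof.
rewrite /binp.
under eq_bigr => i _ do rewrite -[X in _ + polyC X]opprK polyCN.
have fN0 : (k`!%:R : rat)^-1 != 0 by rewrite invr_eq0 pnatr_eq0 -lt0n fact_gt0.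
rewrite size_scale // lead_coefZ (monicP (monic_prod_XsubC _ _ _)) mulr1.
by rewrite size_prod_XsubC -[index_enum _]enumT size_enum_ord.
Qed.

Lemma size_sum_binp (a : int) (c : nat -> rat) (m n : nat) :
  (size (\sum_(m <= k < n) c k *: binp a k)%R <= n)%N.
Proof.
rewrite big_nat; apply: (leq_trans (size_sum _ _ _)); apply/bigmax_leqP_seq => k _.
move=> /andP[_ kn]; apply: (leq_trans (size_scale_leq _ _)).
by rewrite (size_lead_binp _ _).1.
Qed.

Lemma lead_coef_addZ_binp (a : int) (c : rat) (k : nat) (p : {poly rat}) :
  c != 0 -> (size p <= k)%N -> lead_coef (p + c *: binp a k) = c / (k`!)%:R.
Proof.
move=> c0 pk; have [sb lb] := size_lead_binp a k.
by rewrite lead_coefDr; [rewrite lead_coefZ lb | rewrite size_scale // sb ltnS].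
Qed.

(** * From lattice points of a dilate to canonical natural weights *)

Lemma in_dilate_param (R : realType) n (T : finType) (phi : T -> 'S_n)
    (G : {set 'S_n}) (t : nat) (M : 'M[int]_n) :
  injective phi -> G = phi @: [set: T] ->
  in_dilate R G t M <->
  exists c : T -> R, (forall x, 0 <= c x) /\ \sum_x c x = t%:R /\
    forall i j, (M i j)%:~R = \sum_(x | phi x i == j) c x.
Proof.
move=> phi_inj ->.
have sumG (V : nmodType) (F : 'S_n -> V) :
    \sum_(g in phi @: [set: T]) F g = \sum_x F (phi x).
  by rewrite big_imset /=; [apply: eq_bigl => x; rewrite inE | move=> x y _ _ /phi_inj].
have entry (lam : 'S_n -> R) i j :
    (\sum_(g in phi @: [set: T]) lam g *: pmat R g) i j =
    \sum_(x | phi x i == j) lam (phi x).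
  rewrite sumG summxE [RHS]big_mkcond; apply: eq_bigr => x _.
  by rewrite !mxE; case: eqP; rewrite ?mulr1 ?mulr0.
split=> [[lam [lam0 [lamt lamM]]] | [c [c0 [ct cM]]]].
  exists (lam \o phi); split=> [x|] /=; first exact: lam0.
  by split=> [|i j]; [rewrite -lamt sumG | rewrite -entry -lamM mxE].
(* By injectivity this sum has at most one term; it transports [c] along [phi] without an inverse
   map. *)
pose lam g := \sum_(x | phi x == g) c x.
have lamE x : lam (phi x) = c x.
  by rewrite /lam (big_pred1 x) // => y; rewrite (inj_eq phi_inj).
exists lam; split; first by move=> g; apply: sumr_ge0.
split; first by rewrite sumG -ct; apply: eq_bigr => x _; rewrite lamE.
apply/matrixP => i j; rewrite entry mxE cM.
by apply: eq_bigr => x _; rewrite lamE.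
Qed.

Lemma ffun_of_int_weights {R : realType} (T : finType) (t : nat) (c : T -> R) :
  (forall x, 0 <= c x) -> \sum_x c x = t%:R ->
  (forall x, exists z : int, c x = z%:~R) ->
  exists2 f : {ffun T -> 'I_t.+1}, (\sum_x (f x : nat) == t)%N &
    forall x, c x = (f x : nat)%:R.
Proof.
(* The floor recovers the integer value of [c x] without choosing a witness. *)
move=> c0 ct cz; pose d x := absz (Num.floor (c x)).
have dE x : c x = (d x)%:R.
  have [z e] := cz x; rewrite /d e intrKfloor pmulrn gez0_abs //.
  by rewrite -(ler0z R) -e.
have dt : (\sum_x d x = t)%N.
  apply/eqP; rewrite -(eqr_nat R) -ct natr_sum; apply/eqP.
  by apply: eq_bigr => x _; rewrite dE.
have dlt x : (d x < t.+1)%N by rewrite ltnS -dt (bigD1 x) //= leq_addr.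
exists [ffun x => inord (d x)] => [|x]; last by rewrite ffunE inordK -?dE.
by rewrite -[X in _ == X]dt; apply/eqP/eq_bigr => x _; rewrite ffunE inordK.
Qed.

(** [red] singles out one weight among all those giving the same matrix: the third hypothesis is
    uniqueness, the fourth is existence of a natural representative of the same mass. Lattice points
    of the dilate then correspond bijectively to the reduced weights being counted. *)
Lemma ehrhart_of_count (R : realType) n (T : finType) (phi : T -> 'S_n)
    (G : {set 'S_n}) (red : pred (T -> nat)) (p : {poly rat}) :
  injective phi -> G = phi @: [set: T] ->
  (forall (c d : T -> nat), red c -> red d ->
     (forall i j, \sum_(x | phi x i == j) c x = \sum_(x | phi x i == j) d x)%N ->
     c =1 d) ->
  (forall (t : nat) (M : 'M[int]_n) (c : T -> R),
     (forall x, 0 <= c x) -> \sum_x c x = t%:R ->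
     (forall i j, (M i j)%:~R = \sum_(x | phi x i == j) c x) ->
     exists2 f : {ffun T -> 'I_t.+1},
       (\sum_x (f x : nat) == t)%N && red (fun x => f x) &
       forall i j, \sum_(x | phi x i == j) (f x : nat)%:R =
                   \sum_(x | phi x i == j) c x) ->
  (forall t, (0 < t)%N ->
     #|[set f : {ffun T -> 'I_t.+1} |
         (\sum_x (f x : nat) == t)%N && red (fun x => f x)]|%:R = p.[t%:R]) ->
  ehrhart R G p.
Proof.
move=> phi_inj GE red_inj red_ex cnt t t0.
pose mat (f : {ffun T -> 'I_t.+1}) : 'M[int]_n :=
  \matrix_(i, j) (\sum_(x | phi x i == j) (f x : nat))%N%:Z.
set A := [set f : {ffun T -> 'I_t.+1} | (\sum_x (f x : nat) == t)%N && red (fun x => f x)].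
exists [seq mat f | f <- enum A]; split; [|split]; last by rewrite size_map -cardE cnt.
  rewrite map_inj_in_uniq ?enum_uniq // => f g.
  rewrite !mem_enum !inE => /andP[_ rf] /andP[_ rg] /matrixP e.
  apply/ffunP => x; apply: val_inj; apply: (red_inj _ _ rf rg) => i j.
  by have := e i j; rewrite !mxE => -[].
move=> M; rewrite (in_dilate_param _ _ _ _ _ t M phi_inj GE); split.
  case/mapP => f; rewrite mem_enum inE => /andP[/eqP sf _] ->.
  exists (fun x => (f x : nat)%:R); split=> [x|]; first exact: ler0n.
  by split=> [|i j]; rewrite -?natr_sum ?sf // mxE -pmulrn natr_sum.
case=> c [c0 [ct cM]]; have [f fA fM] := red_ex t M c c0 ct cM.
apply/mapP; exists f; first by rewrite mem_enum inE.
apply/matrixP => i j; apply/eqP; rewrite -(eqr_int R) cM -fM mxE.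
by rewrite -pmulrn natr_sum.
Qed.

(** * The groups as explicit affine maps of Z/n *)

Section Groups.
Variable p : nat.
Local Notation n := p.+3.

Definition rotation (k : 'I_n) : 'S_n := perm (addIr k).
Definition reflection (l : 'I_n) : 'S_n := perm (subrI l).
Definition dihedral (x : bool * 'I_n) : 'S_n :=
  if x.1 then reflection x.2 else rotation x.2.

Lemma rotationE k i : rotation k i = i + k. Proof. by rewrite permE. Qed.
Lemma reflectionE l i : reflection l i = l - i. Proof. by rewrite permE. Qed.

Lemma rotE : Defs.rot n = rotation 1.
Proof.
apply/permP => i; rewrite rotationE permE; apply: val_inj => /=.
by rewrite [in RHS](modn_small (_ : 1 < n)%N) ?addn1.
Qed.

Lemma flipE : flip n = reflection (- 1).
Proof.
(* Adding [i + 1] to both sides turns the right one into 0, so no negative residue has to be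
   computed. *)
apply/permP => i; rewrite reflectionE permE; apply: (addIr (i + 1)).
rewrite -opprD addrC addrC [1 + i]addrC addNr; apply: val_inj => /=.
by rewrite [(1 %% _)%N]modn_small // !modnDmr addn1 subnK ?modnn.
Qed.

Lemma rotationX k m : (rotation k ^+ m)%g = rotation (k *+ m).
Proof.
elim: m => [|m IHm]; apply/permP => i; first by rewrite perm1 rotationE addr0.
by rewrite expgSr permM IHm !rotationE mulrSr addrA.
Qed.

Lemma rotation_cycle k : rotation k = (Defs.rot n ^+ k)%g.
Proof. by rewrite rotE rotationX natr_Zp. Qed.

Lemma Cn_rotation : Cn n = rotation @: [set: 'I_n] :> {set 'S_n}.
Proof.
apply/setP => g; apply/cycleP/imsetP => [[m ->]|[k _ ->]].
  by exists (1 *+ m); rewrite // rotE rotationX.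
by exists k; rewrite rotation_cycle.
Qed.

Lemma dihedralE x i : dihedral x i = if x.1 then x.2 - i else i + x.2.
Proof. by rewrite /dihedral; case: x.1; rewrite ?reflectionE ?rotationE. Qed.

(** The explicit family contains both generators and is closed under composition; conversely each of
    its members is a product of generators. *)
Lemma Dn_dihedral : Dn n = dihedral @: [set: bool * 'I_n] :> {set 'S_n}.
Proof.
apply/eqP; rewrite eqEsubset; apply/andP; split.
  have gD : group_set (dihedral @: [set: bool * 'I_n]).
    apply/group_setP; split.
      apply/imsetP; exists (false, 0) => //; apply/permP => i.
      by rewrite perm1 dihedralE addr0.
    move=> _ _ /imsetP[[b k] _ ->] /imsetP[[c l] _ ->].
    apply/imsetP; exists (b (+) c, (if c then l - k else k + l)) => //.
    apply/permP => i; rewrite permM !dihedralE /=.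
    case: b; case: c => /=.
    - by rewrite opprB addrCA.
    - by rewrite addrAC.
    - by rewrite opprD addrA addrAC.
    - by rewrite addrA.
  suff : [set Defs.rot n; flip n] \subset Group gD by rewrite -gen_subG.
  apply/subsetP => g.
  rewrite !inE => /orP[] /eqP ->; apply/imsetP.
    by exists (false, 1); rewrite ?rotE.
  by exists (true, -1); rewrite ?flipE.
have rD : Defs.rot n \in Dn n by rewrite mem_gen // !inE eqxx.
have fD : flip n \in Dn n by rewrite mem_gen // !inE eqxx orbT.
apply/subsetP => g /imsetP[[b k] _ ->]; rewrite /dihedral /=; case: b; last first.
  by rewrite rotation_cycle groupX.
(* The flip sends [i] to [-1 - i], so a further rotation by [k + 1] yields [k - i]. *)
suff -> : reflection k = (flip n * Defs.rot n ^+ (k + 1)%R)%g by rewrite groupM // groupX.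
apply/permP => i; rewrite -rotation_cycle permM flipE reflectionE rotationE reflectionE.
by rewrite [RHS]addrC addrA addrK.
Qed.

Lemma rotation_inj : injective rotation.
Proof.
by move=> k l /permP/(_ 0); rewrite !rotationE !add0r.
Qed.

Lemma dihedral_inj : injective dihedral.
Proof.
move=> [b k] [c l] /permP e.
(* The value at 0 determines the parameter and the value at 1 the sign: a rotation equal to a
   reflection would force [-1 = 1], impossible for [n > 2]. *)
move: (e 0) (e 1) => {e}; rewrite !dihedralE /=.
have neq : (-1 : 'I_n) <> 1.
  by move/(congr1 val)/eqP; rewrite /= !modn_small ?subn1.
case: b; case: c; rewrite ?subr0 ?add0r => -> //.
  by rewrite addrC => /addIr.
by rewrite [RHS]addrC => /addIr /esym.
Qed.

End Groups.

(** * Reduced weights for the dihedral group and their number *)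

Lemma sum_bool_pair (V : nmodType) (T : finType) (c : bool * T -> V) :
  \sum_x c x = \sum_k c (true, k) + \sum_k c (false, k).
Proof.
rewrite (eq_bigr (fun x => c (x.1, x.2))) => [|[] //].
by rewrite -(pair_bigA _ (fun b k => c (b, k))) big_bool.
Qed.

Section Dihedral.
Variable p : nat.
Local Notation n := p.+3.

Lemma sum_rotation (V : nmodType) (c : 'I_n -> V) i j :
  \sum_(k | rotation p k i == j) c k = c (j - i).
Proof.
apply: big_pred1 => k; rewrite rotationE addrC.
by apply/eqP/eqP => [<-|->]; rewrite ?addrK ?subrK.
Qed.

(** Exactly one rotation and exactly one reflection send [i] to [j]. *)
Lemma sum_dihedral (V : nmodType) (c : bool * 'I_n -> V) i j :
  \sum_(x | dihedral p x i == j) c x = c (false, j - i) + c (true, i + j).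
Proof.
rewrite big_mkcond sum_bool_pair -!big_mkcond [RHS]addrC; congr (_ + _).
  apply: (big_pred1 (i + j)) => k; rewrite dihedralE /= [i + j]addrC.
  by rewrite subr_eq.
exact: (sum_rotation _ (fun k => c (false, k))).
Qed.

(* Constantly false for odd n, where doubling is onto and there is a single class. *)
Definition parity (x : 'I_n) : bool := ~~ odd n && odd x.

(** This decides which pairs of weights meet in a matrix entry: [x = j - i] and [y = i + j] have a
    solution [i] exactly when [x + y] is a double modulo [n]. *)
Lemma parityP x y : parity x = parity y <-> exists j, x + y = j + j.
Proof.
rewrite /parity; split=> [pxy|[j e]]; last first.
  have [//|even_n] := boolP (odd n).
  have {e} : odd ((x + y) %% n)%N = odd ((j + j) %% n)%N
    by exact: (congr1 (fun z : 'I_n => odd z) e).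
  rewrite !odd_mod ?(negbTE even_n) // !oddD addbb /=.
  by case: (odd x); case: (odd y).
(* If [x + y] is odd, equality of parities forces [n] to be odd, so adding [n] gives an even number
   in the same residue class. *)
pose m := if odd (x + y)%N then n else 0%N.
have m0 : (m = 0 %[mod n])%N by rewrite /m; case: odd; rewrite ?modnn.
have m_even : odd (m + (x + y)) = false.
  move: pxy; rewrite oddD /m oddD; case: ifP; rewrite ?addbF //.
  by case: (odd n); case: (odd x); case: (odd y).
have half : ((m + (x + y))./2.*2 = m + (x + y))%N.
  by rewrite -[RHS]odd_double_half m_even.
exists (inZp ((m + (x + y))./2)); apply: val_inj; rewrite /= modnDm addnn half.
by rewrite -[RHS]modnDml m0 mod0n add0n.
Qed.

Lemma parity_entry (i j : 'I_n) : parity (j - i) = parity (i + j).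
Proof. by apply/parityP; exists j; rewrite addrA subrK. Qed.

(** Quantifying over [y] covers every parity class, whether there are one or two. For natural
    weights, a zero on a class means that the minimum of the rotation weights there is 0. *)
Definition reduced (c : bool * 'I_n -> nat) : bool :=
  [forall y, exists x, (parity x == parity y) && (c (false, x) == 0)]%N.

Lemma reduced_inj (c d : bool * 'I_n -> nat) : reduced c -> reduced d ->
  (forall i j, \sum_(x | dihedral p x i == j) c x = \sum_(x | dihedral p x i == j) d x)%N ->
  c =1 d.
Proof.
move=> /forallP rc /forallP rd e.
have ab x y : parity x = parity y ->
    (c (false, x) + c (true, y) = d (false, x) + d (true, y))%N.
  (* The entry in row [j - x] and column [j] is the sum of the weights of rotation [x] and
     reflection [y]. *)
  move=> /parityP[j xy]; have := e (j - x) j; rewrite !(sum_dihedral nat).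
  have -> : j - (j - x) = x by rewrite opprB addrCA subrr addr0.
  by have -> : j - x + j = y by rewrite addrAC -xy addrC addKr.
have b y : c (true, y) = d (true, y).
  (* A zero of [c] in the class of [y] bounds [d (true, y)] by [c (true, y)], and a zero of [d]
     gives the converse bound. *)
  have /existsP[x /andP[/eqP pxy /eqP cx]] := rc y.
  have /existsP[x' /andP[/eqP pxy' /eqP dx]] := rd y.
  have := ab _ _ pxy; have := ab _ _ pxy'; rewrite cx dx; lia.
by case=> [[] x] //; have := ab _ _ (erefl (parity x)); rewrite b => /addIn.
Qed.

Lemma reduced_ex (R : realType) (t : nat) (M : 'M[int]_n) (c : bool * 'I_n -> R) :
  (forall x, 0 <= c x) -> \sum_x c x = t%:R ->
  (forall i j, (M i j)%:~R = \sum_(x | dihedral p x i == j) c x) ->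
  exists2 f : {ffun bool * 'I_n -> 'I_t.+1},
    (\sum_x (f x : nat) == t)%N && reduced (fun x => f x) &
    forall i j, \sum_(x | dihedral p x i == j) (f x : nat)%:R =
                \sum_(x | dihedral p x i == j) c x.
Proof.
move=> c0 ct cM.
pose mu y := [arg min_(x < y | parity x == parity y) c (false, x)]%O.
have muP y : parity (mu y) = parity y /\
    forall x, parity x = parity y -> c (false, mu y) <= c (false, x).
  rewrite /mu; case: arg_minP => // x /eqP px le; split=> // z pz.
  by apply: le; rewrite pz.
have mu_eq x y : parity x = parity y -> c (false, mu x) = c (false, mu y).
  move=> e; have [px lex] := muP x; have [py ley] := muP y; apply/eqP.
  by rewrite eq_le lex ?ley //; congruence.
(* The class minimum moves from the rotations to the reflections: entries and total mass are
   unchanged, and the rotation weight at [mu y] becomes 0. *)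
pose d (x : bool * 'I_n) :=
  if x.1 then c (true, x.2) + c (false, mu x.2) else c (false, x.2) - c (false, mu x.2).
have shift (u v w : R) : u + v + (w - v) = u + w by rewrite addrACA subrr addr0.
have sum_d : \sum_x d x = t%:R.
  rewrite -ct !sum_bool_pair -!big_split; apply: eq_bigr => x _; rewrite /d /=.
  exact: shift.
have d0 x : 0 <= d x.
  case: x => [[] x]; rewrite /d /=; first exact: addr_ge0.
  by rewrite subr_ge0; apply: (muP x).2.
have dM i j : d (false, j - i) + d (true, i + j) = (M i j)%:~R.
  rewrite cM sum_dihedral /d /= (mu_eq _ _ (parity_entry i j)).
  by rewrite [LHS]addrC [RHS]addrC; exact: shift.
(* The entry pairing rotation [mu y] with reflection [y] equals [d (true, y)] alone, so that weight
   is an integer; rotation weights then follow by subtraction. *)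
have dz_true y : exists z : int, d (true, y) = z%:~R.
  have /parityP[j e] := (muP y).1.
  exists (M (j - mu y) j); rewrite -dM.
  have -> : j - (j - mu y) = mu y by rewrite opprB addrCA subrr addr0.
  have -> : j - mu y + j = y by rewrite addrAC -e addrC addKr.
  by rewrite [X in X + _]/d /= (mu_eq _ _ (muP y).1) subrr add0r.
have dz x : exists z : int, d x = z%:~R.
  case: x => [[] x] //.
  have /parityP[j e] := erefl (parity x); have [z ze] := dz_true x.
  exists (M (j - x) j - z); rewrite intrB -ze -dM.
  have -> : j - (j - x) = x by rewrite opprB addrCA subrr addr0.
  have -> : j - x + j = x by rewrite addrAC -e addrC addKr.
  by rewrite addrK.
have [f sf fd] := ffun_of_int_weights _ t d d0 sum_d dz.
exists f; last by move=> i j; rewrite -cM -dM sum_dihedral !fd.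
rewrite sf; apply/forallP => y; apply/existsP; exists (mu y).
rewrite (muP y).1 eqxx -(eqr_nat R) -fd /d /= (mu_eq _ _ (muP y).1) subrr.
by rewrite eqxx.
Qed.

Definition parity_class u : {set bool * 'I_n} := [set x | ~~ x.1 && (parity x.2 == u)].

(** Taking [K] empty gives all weights of mass [t]. *)
Definition positive_on t (K : {set bool * 'I_n}) : {set {ffun bool * 'I_n -> 'I_t.+1}} :=
  [set f : {ffun bool * 'I_n -> 'I_t.+1} | (\sum_x (f x : nat) == t) && [forall x in K, 0 < f x]]%N.

Lemma card_positive_on t K : (0 < t)%N ->
  #|positive_on t K| = 'C(n.*2 - #|K| + t.-1, n.*2.-1).
Proof.
by move=> t0; rewrite card_ffun_sum_pos ?card_prod ?card_bool ?card_ord ?mul2n.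
Qed.

Lemma not_reduced t (f : {ffun bool * 'I_n -> 'I_t.+1}) :
  ~~ reduced (fun x => f x) =
  [exists y, [forall x in parity_class (parity y), 0 < f x]]%N.
Proof.
rewrite negb_forall; apply: eq_existsb => y; rewrite negb_exists.
apply/forallP/forall_inP => [h [b x]|h x].
  rewrite inE /= => /andP[/negbTE -> /eqP e]; have := h x.
  by rewrite e eqxx /= lt0n.
rewrite negb_and; case: eqP => //= e.
by rewrite -lt0n; apply: h; rewrite inE /= e.
Qed.

(** There is a single class, made of all [n] rotations, and the weights to discard are those
    positive on it. The additive form avoids truncated subtraction. *)
Lemma card_reduced_odd t : odd n -> (0 < t)%N ->
  (#|[set f : {ffun bool * 'I_n -> 'I_t.+1} |
      (\sum_x (f x : nat) == t)%N && reduced (fun x => f x)]| +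
   'C(n.*2 - n + t.-1, n.*2.-1) = 'C(n.*2 + t.-1, n.*2.-1))%N.
Proof.
move=> n_odd t0.
have par x : parity x = false by rewrite /parity n_odd.
have cK : #|parity_class false| = n.
  rewrite -[RHS]card_ord -[RHS]mul1n -(cards1 false) -cardsT -cardsX.
  by apply: eq_card => -[b x]; rewrite !inE par andbT; case: b.
have := card_positive_on t set0 t0; rewrite cards0 subn0 => <-.
have := card_positive_on t (parity_class false) t0; rewrite cK => <-.
rewrite -(cardsID (positive_on t (parity_class false)) (positive_on t set0)) addnC.
congr (_ + _)%N; apply: eq_card => f; rewrite !inE.
  have -> : [forall x in set0, (0 < f x)%N] by apply/forall_inP => x; rewrite inE.
  by rewrite andbT andbA andbb.
have -> : [forall x in set0, (0 < f x)%N] by apply/forall_inP => x; rewrite inE.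
case: eqP => //= _; rewrite andbT -[LHS]negbK not_reduced; congr (~~ _).
apply/existsP/idP => [[y]|h]; first by rewrite par.
by exists 0; rewrite par.
Qed.

(** Translation by 1 flips parity, also across the wrap-around because [n] is even. The two classes
    thus have equal size, and together they contain the [n] rotations. *)
Lemma card_parity_class_even m u : n = m.*2 -> #|parity_class u| = m.
Proof.
move=> nm; have n_even : odd n = false by rewrite nm odd_double.
have parS x : parity (x + 1) = ~~ parity x.
  rewrite /parity n_even; change (odd ((x + 1 %% n) %% n)%N = ~~ odd x).
  by rewrite odd_mod // oddD odd_mod //= addbT.
pose s (x : bool * 'I_n) := (x.1, x.2 + 1).
have s_inj : injective s 
  by apply: (can_inj (g := fun x => (x.1, x.2 - 1))) => -[b x]; rewrite /s addrK.
have cS : (#|parity_class true| = #|parity_class false|)%N.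
  rewrite -[RHS](card_imset _ s_inj); apply: eq_card => -[b x].
  rewrite [X in X = _]inE; apply/idP/imsetP => [/andP[/= b0 /eqP px]|[[c y]]].
    exists (b, x - 1); rewrite ?inE /s /= ?subrK //.
    by rewrite b0 -(negbK (parity _)) -parS subrK px.
  by rewrite inE /s /= => /andP[c0 /eqP py] [-> ->]; rewrite parS py c0.
have cU : (#|parity_class true| + #|parity_class false| = n)%N.
  rewrite -[RHS]card_ord -[RHS]mul1n -(cards1 false) -cardsT -cardsX.
  rewrite -[RHS](cardsID (parity_class true)); congr (_ + _)%N;
    apply: eq_card => -[b x]; rewrite !inE /=; case: b; case: (parity x) => //=.
by case: u; lia.
Qed.

(** Inclusion-exclusion over the two classes of size [m]; being positive on both means being
    positive on all [n] rotations. *)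
Lemma card_reduced_even t m : n = m.*2 -> (0 < t)%N ->
  (#|[set f : {ffun bool * 'I_n -> 'I_t.+1} |
      (\sum_x (f x : nat) == t)%N && reduced (fun x => f x)]| +
   2 * 'C(n.*2 - m + t.-1, n.*2.-1) =
   'C(n.*2 + t.-1, n.*2.-1) + 'C(n.*2 - m.*2 + t.-1, n.*2.-1))%N.
Proof.
move=> nm t0; rewrite -nm; have n_even : odd n = false by rewrite nm odd_double.
set K := parity_class; set P := positive_on t.
have KU : #|K true :|: K false| = n.
  rewrite cardsU !(card_parity_class_even m) //.
  rewrite [#|_ :&: _|]eq_card0 ?subn0 ?addnn // => x.
  by rewrite !inE; case: (parity _); rewrite ?andbF.
have PU : P (K true) :&: P (K false) = P (K true :|: K false).
  apply/setP => f; rewrite !inE; case: eqP => //= _.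
  apply/andP/forall_inP => [[/forall_inP h1 /forall_inP h2] x|h].
    by rewrite inE => /orP[/h1|/h2].
  by split; apply/forall_inP => x xK; apply: h; rewrite inE xK ?orbT.
have := card_positive_on t set0 t0; rewrite cards0 subn0 => <-.
have := card_positive_on t (K true :|: K false) t0; rewrite KU => <-.
have := card_positive_on t (K true) t0.
have := card_positive_on t (K false) t0.
rewrite !(card_parity_class_even m) // -/P => cF cT.
have T0 f : [forall x in set0, (0 < (f : {ffun bool * 'I_n -> 'I_t.+1}) x)%N].
  by apply/forall_inP => x; rewrite inE.
have sub : P (K true) :|: P (K false) \subset P set0.
  apply/subsetP => f; rewrite !inE T0 andbT.
  by case/orP => /andP[].
have := cardsD (P set0) (P (K true) :|: P (K false)).
rewrite (setIidPr sub) cardsU PU.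
have -> : #|P set0 :\: (P (K true) :|: P (K false))| =
  #|[set f : {ffun bool * 'I_n -> 'I_t.+1} |
      (\sum_x (f x : nat) == t)%N && reduced (fun x => f x)]|.
  apply: eq_card => f; rewrite !inE T0; case: eqP => //= _; rewrite andbT.
  rewrite -[RHS]negbK not_reduced; congr (~~ _).
  apply/orP/existsP => [[h|h]|[y]].
  - by exists 1; rewrite /parity n_even.
  - by exists 0; rewrite /parity n_even.
  - by case: (parity y) => h; [left | right].
(* The cardinality formulas contain truncated subtractions; this bound and the next make them
   exact. *)
have := subset_leq_card sub; rewrite cardsU PU cF cT.
have : (#|P (K true :|: K false)| <= #|P (K true)|)%N.
  by rewrite -PU subset_leq_card // subsetIl.
rewrite cT; lia.
Qed.

End Dihedral.

(** * Values and leading coefficients of the stated polynomials *)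

(* The guard matters: the truncated k.+1 - j would give 'C(_, 0) = 1 for k.+1 < j. *)
Definition tail_bin (N j k : nat) : rat :=
  if (j <= k.+1)%N then 'C(N - j, k.+1 - j)%:R else 0.

Lemma horner_sum_tail_bin (N j t : nat) : (0 < N)%N -> (j <= N)%N -> (0 < t)%N ->
  \sum_(0 <= k < N) tail_bin N j k * (binp (-1) k).[t%:R] = 'C(N - j + t.-1, N.-1)%:R.
Proof.
move=> N0 jN t0; rewrite -sum_bin_bin // natr_sum [RHS]big_mkcond.
apply: eq_bigr => k _; rewrite (horner_binp _ _ t.-1); last lia.
by rewrite /tail_bin; case: ifP; rewrite ?mul0r ?natrM.
Qed.

(** Indexing from the top makes the last few coefficients binomials with a small lower index. *)
Lemma tail_bin_sub (N j i : nat) : (i < N)%N -> (j <= N - i)%N ->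
  tail_bin N j (N - i.+1) = 'C(N - j, i)%:R.
Proof.
move=> iN jNi; rewrite /tail_bin ifT; last lia.
by rewrite -(@bin_sub (N - j) i); [congr (_%:R); congr 'C(_, _); lia | lia].
Qed.

Definition coef_odd (n k : nat) : rat := tail_bin n.*2 0 k - tail_bin n.*2 n k.

(* coef_odd n vanishes at k = n.*2.-1, which lets Vandermonde's sum be used;
   coef_even m likewise vanishes at the two missing indices. *)
Lemma ehrD_oddE n : (0 < n)%N ->
  ehrD_odd n = \sum_(0 <= k < n.*2.-1) coef_odd n k *: binp (-1) k.
Proof.
move=> n0; rewrite [RHS](big_cat_nat (n := n.-1)) /=; [|lia..].
rewrite /ehrD_odd; congr (_ + _); rewrite !big_nat; apply: eq_bigr => k hk;
  rewrite /coef_odd /tail_bin !subn0.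
  by rewrite ifF ?subr0 //; lia.
by rewrite ifT; [congr ((_ - 'C(_, _)%:R) *: _); lia | lia].
Qed.

Lemma horner_ehrD_odd n t : (0 < n)%N -> (0 < t)%N ->
  (ehrD_odd n).[t%:R] =
  'C(n.*2 + t.-1, n.*2.-1)%:R - 'C(n.*2 - n + t.-1, n.*2.-1)%:R.
Proof.
move=> n0 t0; rewrite -[X in 'C(X + _, _)]subn0 -!horner_sum_tail_bin //; try lia.
rewrite -sumrB ehrD_oddE // horner_sum.
rewrite [RHS](big_cat_nat (n := n.*2.-1)) /=; [|lia..].
rewrite [X in _ = _ + X]big_ltn; last lia.
rewrite [X in _ = _ + (_ + X)]big_geq ?addr0 -?mulrBl; last lia.
have -> : n.*2.-1 = (n.*2 - 1)%N by lia.
rewrite !tail_bin_sub ?bin0 ?subrr ?mul0r ?addr0; try lia.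
by apply: eq_bigr => k _; rewrite hornerZ mulrBl.
Qed.

Lemma lead_coef_ehrD_odd n : (1 < n)%N ->
  lead_coef (ehrD_odd n) = n%:R / (n.*2.-2)`!%:R.
Proof.
move=> n0; rewrite ehrD_oddE; last lia.
have e : n.*2.-1 = n.*2.-2.+1 by lia.
rewrite e big_nat_recr //=.
(* The top coefficient is ['C(2n, 1) - 'C(n, 1)]. *)
have w : coef_odd n n.*2.-2 = n%:R.
  have -> : n.*2.-2 = (n.*2 - 2)%N by lia.
  rewrite /coef_odd !tail_bin_sub; try lia.
  by rewrite !bin1 -natrB; [congr (_%:R); lia | lia].
by rewrite w lead_coef_addZ_binp ?size_sum_binp // pnatr_eq0; lia.
Qed.

Definition coef_even (m k : nat) : rat :=
  tail_bin (m * 4) 0 k - 2 * tail_bin (m * 4) m k + tail_bin (m * 4) m.*2 k.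

(** The three ranges are those where [k.+1] is below [m], from [m] up to below [2m], and at least
    [2m]; the guards of [tail_bin] switch the corrections on accordingly. *)
Lemma ehrD_evenE m : (1 < m)%N ->
  ehrD_even m = \sum_(0 <= k < (m * 4).-2) coef_even m k *: binp (-1) k.
Proof.
move=> m1; rewrite [RHS](big_cat_nat (n := m.*2.-1)) /=; [|lia..].
rewrite [X in _ = X + _](big_cat_nat (n := m.-1)) /=; [|lia..].
have e : (m.*2.*2 = m * 4)%N by lia.
rewrite /ehrD_even; congr (_ + _ + _); rewrite !big_nat; apply: eq_bigr => k hk;
  rewrite /coef_even /tail_bin !subn0 e.
- by rewrite !ifF ?mulr0 ?subr0 ?addr0 //; lia.
- by rewrite ifT ?ifF ?addr0 //; lia.
- by rewrite !ifT //; lia.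
Qed.

Lemma horner_ehrD_even m t : (1 < m)%N -> (0 < t)%N ->
  (ehrD_even m).[t%:R] =
  'C(m * 4 + t.-1, (m * 4).-1)%:R - 2 * 'C(m * 4 - m + t.-1, (m * 4).-1)%:R
  + 'C(m * 4 - m.*2 + t.-1, (m * 4).-1)%:R.
Proof.
move=> m1 t0; rewrite -[X in 'C(X + _, _)]subn0 -!horner_sum_tail_bin //; try lia.
rewrite mulr_sumr -sumrB -big_split ehrD_evenE // horner_sum.
rewrite [RHS](big_cat_nat (n := (m * 4).-2)) /=; [|lia..].
rewrite [X in _ = _ + X]big_ltn; last lia.
rewrite [X in _ = _ + (_ + X)]big_ltn; last lia.
rewrite [X in _ = _ + (_ + (_ + X))]big_geq ?addr0; last lia.
have -> : (m * 4).-2.+1 = (m * 4 - 1)%N by lia.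
have -> : (m * 4).-2 = (m * 4 - 2)%N by lia.
(* The two extra coefficients are [4m - 2(3m) + 2m] and [1 - 2 + 1], both 0. *)
rewrite !tail_bin_sub ?bin0 ?bin1; try lia.
set b1 := (binp _ _).[_]; set b2 := (binp _ _).[_].
rewrite !natrB; try lia.
rewrite natrM -mul2n natrM.
rewrite [X in _ = _ + X](_ : _ = 0) ?addr0; last by ring.
by apply: eq_bigr => k _; rewrite hornerZ /coef_even -mul2n; ring.
Qed.

Lemma lead_coef_ehrD_even m : (1 < m)%N ->
  lead_coef (ehrD_even m) = (m.*2 ^ 2)%:R / (4 * (m.*2.*2 - 3)`!)%:R.
Proof.
move=> m1; rewrite ehrD_evenE //.
have e : (m * 4).-2 = (m * 4 - 3).+1 by lia.
rewrite e big_nat_recr //=.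
(* The top coefficient is ['C(4m, 2) - 2 'C(3m, 2) + 'C(2m, 2)], that is [m ^ 2], a quarter of the
   square of [2m]. *)
have w : coef_even m (m * 4 - 3) = (m ^ 2)%:R.
  rewrite /coef_even !tail_bin_sub; try lia.
  have c2 a : ('C(a.+1, 2) * 2 = a.+1 * a)%N by rewrite mulnC -mul_bin_diag bin1.
  have c : ('C(m * 4 - 0, 2) + 'C(m * 4 - m.*2, 2) = 2 * 'C(m * 4 - m, 2) + m ^ 2)%N.
    case: m m1 {e} => // k _.
    have := c2 (k * 4 + 3)%N; have := c2 (k * 3 + 2)%N; have := c2 (k * 2 + 1)%N.
    have -> : (k.+1 * 4 - 0 = (k * 4 + 3).+1)%N by lia.
    have -> : (k.+1 * 4 - k.+1.*2 = (k * 2 + 1).+1)%N by lia.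
    have -> : (k.+1 * 4 - k.+1 = (k * 3 + 2).+1)%N by lia.
    nia.
  move/(congr1 (fun a => a%:R : rat)): c; rewrite !natrD natrM => c.
  by rewrite addrAC c; ring.
rewrite w lead_coef_addZ_binp ?size_sum_binp ?pnatr_eq0 //; last nia.
have -> : (m.*2.*2 - 3 = m * 4 - 3)%N by lia.
have -> : (m.*2 ^ 2 = 4 * m ^ 2)%N by nia.
by rewrite !natrM -mulf_div divff // mul1r.
Qed.

(** * Ehrhart polynomials of the three families, then the volumes *)

Lemma ehrhart_Cn (R : realType) (p : nat) : ehrhart R (Cn p.+3) (ehrC p.+3).
Proof.
apply: (ehrhart_of_count R p.+3 'I_p.+3 (rotation p) _ predT) => //.
- exact: rotation_inj.
- exact: Cn_rotation.
(* Row 0 of the matrix lists the weights themselves, so they are unique and integral, and the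
   trivial predicate suffices as reduction. *)
- move=> c d _ _ e x; have := e 0 x.
  by rewrite !(sum_rotation p nat) subr0.
- move=> t M c c0 ct cM.
  have cz x : exists z : int, c x = z%:~R.
    by exists (M 0 x); rewrite cM sum_rotation subr0.
  have [f sf fc] := ffun_of_int_weights _ t c c0 ct cz.
  exists f; first by rewrite sf.
  by move=> i j; apply: eq_bigr => x _; rewrite fc.
move=> t t0; rewrite /ehrC (horner_binp _ _ (p.+2 + t)); last by rewrite addrC.
have := card_ffun_sum 'I_p.+3 t; rewrite card_ord => <- //.
by congr (_%:R); apply: eq_card => f; rewrite !inE andbT.
Qed.

Lemma ehrhart_Dn_odd (R : realType) (p : nat) : odd p.+3 ->
  ehrhart R (Dn p.+3) (ehrD_odd p.+3).
Proof.
move=> n_odd; apply: (ehrhart_of_count R p.+3 _ (dihedral p) _ (reduced p)).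
- exact: dihedral_inj.
- exact: Dn_dihedral.
- exact: reduced_inj.
- exact: reduced_ex.
move=> t t0; rewrite horner_ehrD_odd // -(card_reduced_odd p t n_odd t0).
by rewrite natrD addrK.
Qed.

Lemma ehrhart_Dn_even (R : realType) (p m : nat) : p.+3 = m.*2 ->
  ehrhart R (Dn p.+3) (ehrD_even m).
Proof.
move=> nm; apply: (ehrhart_of_count R p.+3 _ (dihedral p) _ (reduced p)).
- exact: dihedral_inj.
- exact: Dn_dihedral.
- exact: reduced_inj.
- exact: reduced_ex.
move=> t t0; rewrite horner_ehrD_even //; last lia.
have := card_reduced_even p t m nm t0.
have -> : (p.+3.*2 = m * 4)%N by lia.
move/(congr1 (fun a => a%:R : rat)); rewrite natrD natrM [X in _ = X -> _]natrD => e.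
by rewrite addrAC -e addrK.
Qed.

Theorem theorem1 (R : realType) (n : nat) (hn : (2 < n)%N) :
  (volume R (Cn n) (((n.-1)`!)%:R^-1) /\ ehrhart R (Cn n) (ehrC n)) /\
  (odd n ->
     volume R (Dn n) (n%:R / ((n.*2).-2)`!%:R) /\ ehrhart R (Dn n) (ehrD_odd n)) /\
  (forall m : nat, n = m.*2 ->
     volume R (Dn n) ((n ^ 2)%:R / (4 * ((n.*2 - 3)`!))%:R) /\
     ehrhart R (Dn n) (ehrD_even m)).
Proof.
case: n hn => [|[|[|p]]] // _; split; [|split=> [n_odd | m nm]].
- have hC := ehrhart_Cn R p; split=> //; exists (ehrC p.+3); split=> //.
  exact: (size_lead_binp _ _).2.
- have hD := ehrhart_Dn_odd R p n_odd; split=> //; exists (ehrD_odd p.+3); split=> //.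
  exact: lead_coef_ehrD_odd.
- have hD := ehrhart_Dn_even R p m nm; split=> //; exists (ehrD_even m); split=> //.
  by rewrite lead_coef_ehrD_even ?nm //; lia.
Qed.
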